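(* Let $\mathrm{L}=\mathcal R\cup\mathcal D$ be a relational $\omega$-signature, $\kappa$ a cardinal, $\mathcal C$ a set of constants disjoint from $\mathrm{L}$ with $|\mathcal C|\le\kappa$, and $S\subseteq[\mathrm{L}(\mathcal C)_{\kappa\omega}]^{<\omega}$ a consistency property. Then $\mathcal A_S$ is an $\mathrm{RO}(\mathbb P_S)$-valued model with the mixing property, and for every $s\in S$, $$[\![\textstyle\bigwedge s]\!]^{\mathcal A_S}_{\mathrm{RO}(\mathbb P_S)}=[\![\mathcal A_{\dot G}\models\textstyle\bigwedge s]\!]^{V^{\mathrm{RO}(\mathbb P_S)}}_{\mathrm{RO}(\mathbb P_S)}.$$
   Context: Relational $\omega$-signature: finitary relation symbols $\mathcal R$ and constants $\mathcal D$; $\mathrm{L}(\mathcal C)$ adds the constants of $\mathcal C$; $\mathrm{L}_{\kappa\omega}$-formulae: closure of atomic formulae under $\neg$, conjunctions/disjunctions of fewer than $\kappa$ formulae with jointly finitely many free variables, and finite quantification. $\phi\neg$: $\neg\phi$ for atomic $\phi$; $(\neg\chi)\neg=\chi$; $(\bigwedge\Phi)\neg=\bigvee\{\neg\chi\}$; $(\bigvee\Phi)\neg=\bigwedge\{\neg\chi\}$; $(\forall\bar v\chi)\neg=\exists\bar v\neg\chi$; $(\exists\bar v\chi)\neg=\forall\bar v\neg\chi$. A consistency property is a set $S$ of sets of sentences such that for each $s\in S$: (Con) no $r\in S$ contains both $\phi$ and $\neg\phi$; (Ind.1) $\neg\phi\in s\Rightarrow s\cup\{\phi\neg\}\in S$;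 (Ind.2) $\bigwedge\Phi\in s\Rightarrow s\cup\{\phi\}\in S$ for all $\phi\in\Phi$; (Ind.3) $\forall\bar v\phi(\bar v)\in s\Rightarrow s\cup\{\phi(\bar c)\}\in S$ for all $\bar c\in(\mathcal C\cup\mathcal D)^{|\bar v|}$; (Ind.4) $\bigvee\Phi\in s\Rightarrow s\cup\{\phi\}\in S$ for some $\phi\in\Phi$; (Ind.5) $\exists\bar v\phi(\bar v)\in s\Rightarrow s\cup\{\phi(\bar c)\}\in S$ for some $\bar c\in\mathcal C^{|\bar v|}$; (Str.1) $c=d\in s\Rightarrow s\cup\{d=c\}\in S$; (Str.2) $\{c=d,\phi(d)\}\subseteq s\Rightarrow s\cup\{\phi(c)\}\in S$; (Str.3) for each $d\in\mathcal C\cup\mathcal D$ some $c\in\mathcal C$ has $s\cup\{c=d\}\in S$. $\mathbb P_S$: sets of sentences contained in some element of $S$, ordered by reverse inclusion; $\mathrm{RO}(\mathbb P_S)$ is its Boolean completion (regular open sets of the order topology). For a filter $F$ on $\mathbb P_S$, $\Sigma_F=\bigcup F$ and $\mathcal A_F$ is the Tarski $\mathrm{L}(\mathcal C)$-structure with domain the classes of $\mathcal C\cup\mathcal D$ under $c\cong_F d\iff(c=d)\in\Sigma_F$, $R^{\mathcal A_F}([c_1],\dots,[c_n])$ iff $R(c_1,\dots,c_n)\in\Sigma_F$, constants $d\mapsto[d]$. $V^{\mathsf B}$ is the Boolean valued universe of $\mathsf B$-names, $\dot G$ the canonical name for the generic filter, $\mathcal A_{\dot G}$ the name for $\mathcal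 A_G$; Boolean values $[\![\cdot]\!]^{V^{\mathsf B}}$ extend to infinitary formulae via infima and suprema. $\mathcal A_S$ is the $\mathrm{RO}(\mathbb P_S)$-valued model whose domain is the set of names $\sigma\in V^{\mathrm{RO}(\mathbb P_S)}\cap H_\mu$ with $[\![\sigma\in\mathcal A_{\dot G}]\!]=1$, where $\mu$ is a regular cardinal large enough that $\mathrm{L}\subseteq H_\mu$ and every name forced to be in $\mathcal A_{\dot G}$ is forced equal to one in $H_\mu$; with $[\![R(\sigma_1,\dots,\sigma_n)]\!]^{\mathcal A_S}=[\![\mathcal A_{\dot G}\models R(\sigma_1,\dots,\sigma_n)]\!]^{V^{\mathrm{RO}(\mathbb P_S)}}$ for $R\in\mathcal R$ and also for equality ($[\![\sigma=\tau]\!]^{\mathcal A_S}=[\![\sigma=\tau]\!]^{V^{\mathrm{RO}(\mathbb P_S)}}$), and each constant $d\in\mathcal D\cup\mathcal C$ interpreted by its check name $\check d$. A $\mathsf B$-valued model has the mixing property if for every antichain $A\subseteq\mathsf B$ and family $\{\tau_a:a\in A\}$ in its domain there is $\tau$ with $a\le[\![\tau=\tau_a]\!]$ for all $a\in A$.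
   Formalization: Constants d are interpreted in A_S by a name forced equal to the class [d] (a check name of d is not forced to lie in A_G, so the literal clause is undefined), and C ∪ D is assumed nonempty (otherwise A_S is empty and mixing fails for the empty antichain). *)

(* Defs.v *)
From HB Require Import structures.
From mathcomp Require Import all_boot all_order.
From mathcomp Require Import boolp classical_sets functions cardinality topology.

Set Implicit Arguments.
Unset Strict Implicit.
Unset Printing Implicit Defensive.

Import Order.TTheory.
Local Open Scope order_scope.
Local Open Scope classical_set_scope.
Local Open Scope card_scope.

Definition card_lt T U (A : set T) (B : set U) : Prop :=
  A #<= B /\ ~ (B #<= A).

(* A cardinal is represented by any type of that cardinality. *)
Definition regular_card (mu : Type) : Prop :=
  infinite_set [set: mu] /\
  forall (I : set mu) (F : mu -> set mu),
    card_lt I [set: mu] -> (forall i, I i -> card_lt (F i) [set: mu]) ->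
    card_lt (\bigcup_(i in I) F i) [set: mu].

Section Syntax.
Variables (rel : Type) (ar : rel -> nat) (cst kappa : Type).

Inductive term := Var of nat | Cst of cst.

(* And J F is the conjunction of the set {F i | i in J}; as |J| < kappa in
   L_{kappa omega}, the index set J can be taken inside kappa. *)
Inductive fml :=
| Eq of term & term
| Rel r of (ar r).-tuple term
| Neg of fml
| And (J : set kappa) of (J -> fml)
| Or (J : set kappa) of (J -> fml)
| All of seq nat & fml
| Ex of seq nat & fml.

Definition tfv (t : term) : set nat := if t is Var n then [set n] else set0.

Fixpoint fv (phi : fml) : set nat :=
  match phi with
  | Eq t u => tfv t `|` tfv u
  | Rel r ts => \bigcup_i tfv (tnth ts i)
  | Neg phi => fv phi
  | And J F | Or J F => \bigcup_i fv (F i)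
  | All vs phi | Ex vs phi => fv phi `\` [set` vs]
  end.

Fixpoint Lkw (phi : fml) : Prop :=
  match phi with
  | Eq _ _ | Rel _ _ => True
  | Neg phi => Lkw phi
  | And J F | Or J F =>
      [/\ card_lt J [set: kappa], finite_set (\bigcup_i fv (F i))
        & forall i, Lkw (F i)]
  | All vs phi | Ex vs phi => uniq vs /\ Lkw phi
  end.

Definition sentence (phi : fml) : Prop := Lkw phi /\ fv phi = set0.

(* The operation written phi followed by the negation sign. *)
Definition moveneg (phi : fml) : fml :=
  match phi with
  | Eq _ _ | Rel _ _ => Neg phi
  | Neg chi => chi
  | And J F => Or (fun i : J => Neg (F i))
  | Or J F => And (fun i : J => Neg (F i))
  | All vs chi => Ex vs (Neg chi)
  | Ex vs chi => All vs (Neg chi)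
  end.

Definition tsubst (e : nat -> option cst) (t : term) : term :=
  if t is Var n then if e n is Some c then Cst c else t else t.

Fixpoint fsubst (e : nat -> option cst) (phi : fml) : fml :=
  match phi with
  | Eq t u => Eq (tsubst e t) (tsubst e u)
  | Rel r ts => Rel [tuple of map (tsubst e) ts]
  | Neg phi => Neg (fsubst e phi)
  | And J F => And (fun i : J => fsubst e (F i))
  | Or J F => Or (fun i : J => fsubst e (F i))
  | All vs phi => All vs (fsubst (fun n => if n \in vs then None else e n) phi)
  | Ex vs phi => Ex vs (fsubst (fun n => if n \in vs then None else e n) phi)
  end.

(* phi(cs), for phi = phi(vs): index n vs is out of range when n \notin vs. *)
Definition inst (vs : seq nat) (cs : (size vs).-tuple cst) (phi : fml) : fml :=
  fsubst (fun n => onth cs (index n vs)) phi.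

End Syntax.

Arguments Cst {cst}.
Arguments Var {cst}.
Arguments Eq {rel ar cst kappa}.
Arguments Rel {rel ar cst kappa}.

Section ConsistencyProperty.
Variables (R : Type) (ar : R -> nat) (D C kappa : Type).
Local Notation fml := (fml ar (D + C) kappa).
Local Notation ceq c d := (Eq (Cst c) (Cst d) : fml).

Record consistency_property (S : set (set fml)) : Prop := {
  Con : forall s phi, S s -> ~ (s phi /\ s (Neg phi));
  Ind1 : forall s phi, S s -> s (Neg phi) -> S (s `|` [set moveneg phi]);
  Ind2 : forall s (J : set kappa) (F : J -> fml), S s -> s (And F) ->
    forall i, S (s `|` [set F i]);
  Ind3 : forall s vs phi, S s -> s (All vs phi) ->
    forall cs : (size vs).-tuple (D + C), S (s `|` [set inst cs phi]);
  Ind4 : forall s (J : set kappa) (F : J -> fml), S s -> s (Or F) ->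
    exists i, S (s `|` [set F i]);
  Ind5 : forall s vs phi, S s -> s (Ex vs phi) ->
    exists cs : (size vs).-tuple C,
      S (s `|` [set inst [tuple of map inr cs] phi]);
  Str1 : forall s c d, S s -> s (ceq c d) -> S (s `|` [set ceq d c]);
  Str2 : forall s c d v phi, S s -> s (ceq c d) ->
    s (inst (vs := [:: v]) [tuple d] phi) ->
    S (s `|` [set inst (vs := [:: v]) [tuple c] phi]);
  Str3 : forall s d, S s -> exists c : C, S (s `|` [set ceq (inr c) d])
}.

End ConsistencyProperty.

Fact ro_display : Order.disp_t. Proof. by []. Qed.

Definition RO (X : topologicalType) : Type :=
  [set U : set X | regopen U].

HB.instance Definition _ (X : topologicalType) := Choice.on (RO X).

Section RegularOpen.
Variable X : topologicalType.
Implicit Types U V W : RO X.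

Lemma ro_regopen U : regopen (val U).
Proof. exact: set_mem (valP U). Qed.

Lemma ro_open U : open (val U).
Proof. by rewrite -(ro_regopen U); exact: open_interior. Qed.

Lemma ro_reg_subproof (A : set X) : (closure A)° \in [set U | regopen U].
Proof. exact/mem_set/interior_closed_regopen/closed_closure. Qed.

Definition ro_reg (A : set X) : RO X := SigSub (ro_reg_subproof A).

Lemma ro_meet_subproof U V : val U `&` val V \in [set U | regopen U].
Proof.
apply/mem_set; apply/seteqP; split; last first.
  move=> x UVx; apply: interiorS (@subset_closure _ _) _ _.
  by rewrite (iffLR (interior_id _) (openI (ro_open U) (ro_open V))).
move=> x h; split.
  rewrite -(ro_regopen U); apply: interiorS h; apply: closureS; exact: subIsetl.
rewrite -(ro_regopen V); apply: interiorS h; apply: closureS; exact: subIsetr.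
Qed.

Lemma ro_compl_subproof U : (~` val U)° \in [set U | regopen U].
Proof.
by apply/mem_set/interior_closed_regopen; rewrite closedC; exact: ro_open.
Qed.

Definition ro_le U V : bool := `[< val U `<=` val V >].
Definition ro_meet U V : RO X := SigSub (ro_meet_subproof U V).
Definition ro_join U V : RO X := ro_reg (val U `|` val V).
Definition ro_compl U : RO X := SigSub (ro_compl_subproof U).

Lemma sub_ro_reg (A : set X) : open A -> A `<=` val (ro_reg A).
Proof.
by move=> /interior_id oA x Ax; apply: interiorS (@subset_closure _ _) _ _; rewrite oA.
Qed.

Lemma ro_reg_le (A : set X) V : A `<=` val V -> val (ro_reg A) `<=` val V.
Proof. by move=> AV; rewrite -(ro_regopen V); exact/interiorS/closureS. Qed.

Lemma ro_le_refl : reflexive ro_le.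
Proof. by move=> U; apply/asboolP. Qed.

Lemma ro_le_anti : antisymmetric ro_le.
Proof.
by move=> U V /andP[/asboolP UV /asboolP VU]; apply/val_inj/seteqP.
Qed.

Lemma ro_le_trans : transitive ro_le.
Proof.
by move=> V U W /asboolP UV /asboolP VW; apply/asboolP; exact: subset_trans VW.
Qed.

HB.instance Definition _ :=
  Order.Le_isPOrder.Build ro_display (RO X) ro_le_refl ro_le_anti ro_le_trans.

Lemma ro_lexI U V W : (U <= ro_meet V W) = (U <= V) && (U <= W).
Proof.
apply/asboolP/andP => [h|[/asboolP UV /asboolP UW] x Ux]; last by split; auto.
by split; apply/asboolP => x /h[].
Qed.

Lemma ro_leUx U V W : (ro_join U V <= W) = (U <= W) && (V <= W).
Proof.
apply/asboolP/andP => [h|[/asboolP UW /asboolP VW]]; last first.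
  by apply: ro_reg_le; rewrite subUset.
have oUV : open (val U `|` val V) by apply: openU; exact: ro_open.
have {}h : val U `|` val V `<=` val W.
  by apply: subset_trans h; exact: sub_ro_reg.
by split; apply/asboolP => x Ux; apply: h; [left|right].
Qed.

HB.instance Definition _ := Order.POrder_MeetJoin_isLattice.Build ro_display
  (RO X) ro_lexI ro_leUx.

Lemma ro_meetUl : @left_distributive (RO X) (RO X) Order.meet Order.join.
Proof.
move=> U V W; apply/le_anti; rewrite leUx !leI2 ?leUl ?leUr//; apply/andP; split=> //.
apply/asboolP => x [].
set P := val U `|` val V => Px Wx.
have : ((closure P)° `&` val W) x by [].
rewrite -(iffLR (interior_id _) (openI (@open_interior _ (closure P)) (ro_open W))).
apply: interiorS => y [Py Wy] B By.
have /closureS : P `&` val W `<=` (val U `&` val W) `|` (val V `&` val W).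
  by rewrite setIUl.
apply; last exact: By.
move=> A Ay; have := interior_subset Py.
move=> /(_ (A `&` val W)); rewrite setIA setIAC; apply.
by apply: filterI => //; apply: open_nbhs_nbhs; split => //; exact: ro_open.
Qed.

HB.instance Definition _ :=
  Order.Lattice_Meet_isDistrLattice.Build ro_display (RO X) ro_meetUl.

Lemma ro_le0x U : ro_reg set0 <= U.
Proof. by apply/asboolP/ro_reg_le. Qed.

Lemma ro_lex1 U : U <= ro_reg setT.
Proof. by apply/asboolP => x _; apply: sub_ro_reg => //; exact: openT. Qed.

HB.instance Definition _ := Order.hasBottom.Build ro_display (RO X) ro_le0x.
HB.instance Definition _ := Order.hasTop.Build ro_display (RO X) ro_lex1.

Lemma ro_joinxC U : (U `|` ro_compl U)%O = \top.
Proof.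
apply/val_inj; rewrite /= closureU interiorC.
rewrite (_ : closure (val U) `|` _ = setT) ?closureT//.
by apply/seteqP; split => // x _; have [|nx] := pselect (closure (val U) x);
  [left|right; exact: subset_closure].
Qed.

Lemma ro_meetxC U : (U `&` ro_compl U)%O = \bot.
Proof.
apply/val_inj; rewrite /= closure0 interior0; apply/seteqP; split => // x [Ux].
by move=> /interior_subset.
Qed.

HB.instance Definition _ :=
  Order.TBDistrLattice_hasComplement.Build ro_display (RO X) ro_joinxC ro_meetxC.

Lemma ro_supremums (A : set (RO X)) :
  supremums A (ro_reg (\bigcup_(U in A) val U)).
Proof.
split=> [U AU|V AV].
  apply/asboolP => x Ux; apply: sub_ro_reg; last by exists U.
  by apply: bigcup_open => W _; exact: ro_open.
by apply/asboolP/ro_reg_le => x [U /AV/asboolP]; apply.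
Qed.

Lemma ro_infimums (A : set (RO X)) :
  infimums A (ro_reg ((\bigcap_(U in A) val U)°)).
Proof.
split=> [U AU|V AV].
  by apply/asboolP/ro_reg_le => x /interior_subset; apply.
apply/asboolP => x Vx; apply: sub_ro_reg; first exact: open_interior.
move: Vx; rewrite -[val V](iffLR (interior_id _) (ro_open V)); apply: interiorS.
by move=> y Vy U /AV/asboolP; apply.
Qed.

End RegularOpen.

Section BooleanOperations.
Context {d : Order.disp_t} {B : ctbDistrLatticeType d}.

(* Suprema and infima of families; the index types are often the type of all
   names, which lives in too large a universe for range. *)
Definition Sup (T : Type) (f : T -> B) : B :=
  supremum \bot [set b | exists x, f x = b].
Definition Inf (T : Type) (f : T -> B) : B :=
  infimum \top [set b | exists x, f x = b].
Definition imp (a b : B) : B := (~` a `|` b)%O.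

End BooleanOperations.

(* The ground universe V: well-founded sets {f i | i : J}, with extensional
   equality veq. *)
Inductive vset : Type := VSet (J : Type) of (J -> vset).

Fixpoint veq (x y : vset) : Prop :=
  let: VSet J f := x in let: VSet K g := y in
  (forall j, exists k, veq (f j) (g k)) /\ (forall k, exists j, veq (f j) (g k)).

Fixpoint hereditarily_lt_vset (mu : Type) (x : vset) : Prop :=
  let: VSet J f := x in
  card_lt [set: J] [set: mu] /\ forall j, hereditarily_lt_vset mu (f j).

(* For mu regular, H_mu is the class of sets hereditarily of size < mu. *)
Definition Hmu_vset (mu : Type) (x : vset) : Prop :=
  exists y, veq x y /\ hereditarily_lt_vset mu y.

Definition vempty : vset := VSet (fun x : False => match x with end).
Definition vupair (x y : vset) : vset := VSet (fun b : bool => if b then x else y).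
Definition vpair (x y : vset) : vset := vupair (vupair x x) (vupair x y).
Fixpoint vnat (n : nat) : vset :=
  if n is m.+1 then vupair (vnat m) (vnat m) else vempty.
Definition vseq (s : seq vset) : vset := foldr vpair vempty s.

Section Names.
Context {d : Order.disp_t} (B : ctbDistrLatticeType d).

(* Name f b is the B-name {(f j, b j) | j : J}. *)
Inductive name : Type := Name (J : Type) of (J -> name) & (J -> B).

Definition nindex (x : name) : Type := let: Name J _ _ := x in J.
Definition elt (x : name) : nindex x -> name :=
  let: Name J f _ := x in f.
Definition val_at (x : name) : nindex x -> B :=
  let: Name J _ b := x in b.

(* Extensional equality of names as sets of pairs, not their Boolean equality. *)
Fixpoint name_ext (x y : name) : Prop :=
  let: Name J f a := x in let: Name K g b := y in
  (forall j, exists k, name_ext (f j) (g k) /\ a j = b k) /\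
  (forall k, exists j, name_ext (f j) (g k) /\ a j = b k).

(* The elements of B are treated as atoms. *)
Fixpoint hereditarily_lt_name (mu : Type) (x : name) : Prop :=
  let: Name J f _ := x in
  card_lt [set: J] [set: mu] /\ forall j, hereditarily_lt_name mu (f j).

Definition Hmu_name (mu : Type) (x : name) : Prop :=
  exists y, name_ext x y /\ hereditarily_lt_name mu y.

(* The Boolean value of x = y, with that of membership unfolded. *)
Fixpoint eqB (x y : name) : B :=
  let: Name J f a := x in let: Name K g b := y in
  (Inf (fun j => imp (a j) (Sup (fun k => b k `&` eqB (f j) (g k))))
   `&`
   Inf (fun k => imp (b k) (Sup (fun j => a j `&` eqB (f j) (g k)))))%O.

Definition memB (x y : name) : B :=
  Sup (fun k : nindex y => val_at k `&` eqB x (elt k))%O.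

Fixpoint check (x : vset) : name :=
  let: VSet J f := x in Name (fun j => check (f j)) (fun=> \top).

Definition name_upair (x y : name) : name :=
  Name (fun b : bool => if b then x else y) (fun=> \top).
Definition name_pair (x y : name) : name :=
  name_upair (name_upair x x) (name_upair x y).
Definition name_tuple n (xs : 'I_n -> name) : name :=
  foldr (fun i => name_pair (xs i)) (check vempty) (enum 'I_n).

Definition name_bigcup (x : name) : name :=
  Name (fun jk : {j : nindex x & nindex (elt j)} => elt (projT2 jk))
       (fun jk => val_at (projT1 jk) `&` val_at (projT2 jk))%O.

End Names.

Section Models.
Context {d : Order.disp_t} (B : ctbDistrLatticeType d).
Variables (R : Type) (ar : R -> nat) (cst kappa : Type).

(* Tuples of elements of a structure are functions on 'I_n: names live in too
   large a universe for n.-tuple. *)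
Definition update T (e : nat -> T) (vs : seq nat) (xs : 'I_(size vs) -> T) :
    nat -> T :=
  fun n => if insub (index n vs) is Some i then xs i else e n.

Record bstruct := BStruct {
  bdom : Type;
  beq : bdom -> bdom -> B;
  brel : forall r, ('I_(ar r) -> bdom) -> B;
  bcst : cst -> bdom
}.

Record is_bmodel (M : bstruct) : Prop := {
  bdom_nonempty : inhabited (bdom M);
  beq_refl : forall x : bdom M, beq x x = \top;
  beq_sym : forall x y : bdom M, beq x y = beq y x;
  beq_trans : forall x y z : bdom M, (beq x y `&` beq y z <= beq x z)%O;
  brel_congr : forall r (xs ys : 'I_(ar r) -> bdom M),
    ((\meet_(i < ar r) beq (xs i) (ys i)) `&` brel xs <= brel ys)%O
}.

Definition antichain (A : set B) : Prop :=
  forall a b, A a -> A b -> a <> b -> (a `&` b)%O = \bot.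

Definition mixing (M : bstruct) : Prop :=
  forall A : set B, antichain A -> forall t : A -> bdom M,
  exists x : bdom M, forall a : A, (val a <= beq x (t a))%O.

Section Evaluation.
Variable M : bstruct.

Definition btval (e : nat -> bdom M) (t : term cst) : bdom M :=
  match t with Var n => e n | Cst c => bcst M c end.

Fixpoint bval (phi : fml ar cst kappa) (e : nat -> bdom M) : B :=
  match phi with
  | Eq t u => beq (btval e t) (btval e u)
  | Rel r ts => brel (fun i => btval e (tnth ts i))
  | Neg phi => (~` bval phi e)%O
  | And J F => Inf (fun i => bval (F i) e)
  | Or J F => Sup (fun i => bval (F i) e)
  | All vs phi => Inf (fun xs : 'I_(size vs) -> bdom M =>
      bval phi (update e xs))
  | Ex vs phi => Sup (fun xs : 'I_(size vs) -> bdom M =>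
      bval phi (update e xs))
  end.

Definition bval_conj (s : set (fml ar cst kappa)) (e : nat -> bdom M) : B :=
  Inf (fun phi : s => bval (val phi) e).

End Evaluation.

(* A name for a Tarski structure; nrel r names a set of ar r-tuples. *)
Record nstruct := NStruct {
  ndom : name B;
  nrel : R -> name B;
  ncst : cst -> name B
}.

Section Satisfaction.
Variable M : nstruct.

Definition ntval (e : nat -> name B) (t : term cst) : name B :=
  match t with Var n => e n | Cst c => ncst M c end.

Definition memB_tuple n (xs : 'I_n -> name B) : B :=
  (\meet_(i < n) memB (xs i) (ndom M))%O.

(* The value in V^B of "M satisfies phi": quantifiers range over all names and
   are relativized to ndom M. *)
Fixpoint sat (phi : fml ar cst kappa) (e : nat -> name B) : B :=
  match phi with
  | Eq t u => eqB (ntval e t) (ntval e u)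
  | Rel r ts => memB (name_tuple (fun i => ntval e (tnth ts i))) (nrel M r)
  | Neg phi => (~` sat phi e)%O
  | And J F => Inf (fun i => sat (F i) e)
  | Or J F => Sup (fun i => sat (F i) e)
  | All vs phi => Inf (fun xs : 'I_(size vs) -> name B =>
      imp (memB_tuple xs) (sat phi (update e xs)))
  | Ex vs phi => Sup (fun xs : 'I_(size vs) -> name B =>
      (memB_tuple xs `&` sat phi (update e xs))%O)
  end.

Definition sat_conj (s : set (fml ar cst kappa)) (e : nat -> name B) : B :=
  Inf (fun phi : s => sat (val phi) e).

End Satisfaction.

End Models.

Section Forcing.
Variables (R : Type) (ar : R -> nat) (D C kappa : Type).
Local Notation fml := (fml ar (D + C) kappa).

Definition cond (S : set (set fml)) : Type :=
  [set p : set fml | exists2 s, S s & p `<=` s].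

HB.instance Definition _ S := Choice.on (cond S).

Fact cond_display : Order.disp_t. Proof. by []. Qed.

Section Conditions.
Variable S : set (set fml).

Definition cond_le (p q : cond S) : bool := `[< val q `<=` val p >].

Lemma cond_le_refl : reflexive cond_le.
Proof. by move=> p; apply/asboolP. Qed.

Lemma cond_le_anti : antisymmetric cond_le.
Proof.
by move=> p q /andP[/asboolP pq /asboolP qp]; apply/val_inj/seteqP.
Qed.

Lemma cond_le_trans : transitive cond_le.
Proof.
by move=> p q r /asboolP qp /asboolP pr; apply/asboolP; exact: subset_trans qp.
Qed.

HB.instance Definition _ := Order.Le_isPOrder.Build cond_display (cond S)
  cond_le_refl cond_le_anti cond_le_trans.

(* The open sets of the order topology of a forcing notion. *)
Definition down_closed : set (set (cond S)) :=
  [set U | forall p q, U p -> (q <= p)%O -> U q].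

Lemma down_closedT : down_closed setT.
Proof. by []. Qed.

Lemma down_closedI : setI_closed down_closed.
Proof. by move=> U V hU hV p q [Up Vp] qp; split; [exact: hU qp|exact: hV qp]. Qed.

Lemma down_closed_bigU (T : Type) (f : T -> set (cond S)) :
  (forall i, down_closed (f i)) -> down_closed (\bigcup_i f i).
Proof. by move=> hf p q [i _ fp] qp; exists i => //; exact: hf qp. Qed.

HB.instance Definition _ := isOpenTopological.Build (cond S)
  down_closedT down_closedI down_closed_bigU.

End Conditions.

(* The symbols of L(C) are sets; formulae and conditions are coded as sets
   built from them. *)
Variable code : R + (D + C) -> vset.

Definition code_cst (c : D + C) : vset := code (inr c).

Definition code_term (t : term (D + C)) : vset :=
  match t with
  | Var n => vpair (vnat 0) (vnat n)
  | Cst c => vpair (vnat 1) (code_cst c)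
  end.

Fixpoint code_fml (phi : fml) : vset :=
  match phi with
  | Eq t u => vpair (vnat 0) (vpair (code_term t) (code_term u))
  | Rel r ts => vpair (vnat 1) (vpair (code (inl r)) (vseq (map code_term ts)))
  | Neg phi => vpair (vnat 2) (code_fml phi)
  | And J F => vpair (vnat 3) (VSet (fun i => code_fml (F i)))
  | Or J F => vpair (vnat 4) (VSet (fun i => code_fml (F i)))
  | All vs phi => vpair (vnat 5) (vpair (vseq (map vnat vs)) (code_fml phi))
  | Ex vs phi => vpair (vnat 6) (vpair (vseq (map vnat vs)) (code_fml phi))
  end.

Variable S : set (set fml).

Definition code_cond (p : cond S) : vset :=
  VSet (fun phi : val p => code_fml (val phi)).

Notation B := (RO (cond S)).

(* The value of Gdot at p: the regular open set generated by p. *)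
Definition embed (p : cond S) : B := ro_reg [set q | (q <= p)%O].

Definition Gdot : name B := Name (fun p => check B (code_cond p)) embed.

Definition Sigma_dot : name B := name_bigcup Gdot.

Definition in_Sigma (phi : fml) : B := memB (check B (code_fml phi)) Sigma_dot.

(* The name for the class [c]: the elements of A_G are classes, so this, and
   not the check name of the set c, is the interpretation of c. *)
Definition class_name (c : D + C) : name B :=
  Name (fun c' : D + C => check B (code_cst c'))
       (fun c' => in_Sigma (Eq (Cst c) (Cst c'))).

Definition A_Gdot : nstruct B R (D + C) := {|
  ndom := Name class_name (fun=> \top);
  nrel := fun r => Name
    (fun cs : (ar r).-tuple (D + C) => name_tuple (class_name \o tnth cs))
    (fun cs => in_Sigma (Rel r [tuple of map Cst cs]));
  ncst := class_name
|}.

Record large_enough (mu : Type) : Prop := {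
  mu_regular : regular_card mu;
  L_in_Hmu : (forall r, Hmu_vset mu (code (inl r))) /\
             (forall c : D, Hmu_vset mu (code (inr (inl c))));
  names_in_Hmu : forall x : name B, memB x (ndom A_Gdot) = \top ->
    exists2 y, Hmu_name mu y & eqB x y = \top
}.

Definition A_S_dom (mu : Type) : Type :=
  {x : name B | Hmu_name mu x /\ memB x (ndom A_Gdot) = \top}.

(* icst maps each constant c to a name in H_mu that is forced equal to
   class_name c; class_name c itself need not lie in H_mu. *)
Definition A_S (mu : Type) (icst : D + C -> A_S_dom mu) :
    bstruct B ar (D + C) := {|
  bdom := A_S_dom mu;
  beq := fun x y => eqB (sval x) (sval y);
  brel := fun r xs => memB (name_tuple (fun i => sval (xs i))) (nrel A_Gdot r);
  bcst := icst
|}.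

End Forcing.

(* Main.v *)
(* The names satisfy the axioms of equality in V^B, and a family of names
   indexed by an antichain has a mixture. Hence every name x agrees, with value
   at least [x in A_G], with a name that is forced to be in A_G, and the latter
   may be taken in H_mu. This gives the mixing property of A_S, and it shows by
   induction on formulae that quantifying over the domain of A_S amounts to
   quantifying over all names relativized to A_G. *)
Require Import Defs.
From mathcomp Require Import all_boot all_order.
From mathcomp Require Import boolp classical_sets functions cardinality topology.
Local Open Scope order_scope.
Local Open Scope classical_set_scope.
Local Open Scope card_scope.
Import Order.Theory.

Set Implicit Arguments.
Unset Strict Implicit.
Unset Printing Implicit Defensive.

(** * Suprema, infima and implication in a complete Boolean algebra *)

Section CompleteBooleanAlgebra.
Local Open Scope order_scope.
Context {d : Order.disp_t} {B : ctbDistrLatticeType d}.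
Implicit Types a b c : B.

Definition complete_lattice : Prop :=
  forall A : set B, supremums A !=set0 /\ infimums A !=set0.

Lemma le_imp c a b : (c <= imp a b) = (c `&` a <= b).
Proof. by rewrite /imp -leBLR diffE complK. Qed.

Lemma imp_elim c a b : c <= imp a b -> c <= a -> c <= b.
Proof. by rewrite le_imp => cab ca; apply: le_trans cab; rewrite lexI lexx. Qed.

Lemma imp1x a : imp \top a = a.
Proof. by rewrite /imp compl1 join0x. Qed.

Lemma meet_compl_le c a b : c `&` a <= b -> c `&` ~` b <= ~` a.
Proof.
move=> h; rewrite -[~` a]joinx0 -/(imp a \bot) le_imp.
by rewrite meetAC -(meetxC b) leI2.
Qed.

Hypothesis cB : complete_lattice.

(** [supremum] returns its default on the empty set, where [\bot] is the least upper bound, and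
    otherwise chooses a supremum, which exists by completeness. *)
Lemma Sup_supremums (T : Type) (f : T -> B) :
  supremums [set b | exists x, f x = b] (Sup f).
Proof.
rewrite /Sup /supremum; case: eqP => [->|_].
  by split => // b _; exact: le0x.
by have [h _] := cB [set b | exists x, f x = b]; exact: (xgetPex _ h).
Qed.

Lemma Inf_infimums (T : Type) (f : T -> B) :
  infimums [set b | exists x, f x = b] (Inf f).
Proof.
rewrite /Inf /infimum; case: eqP => [->|_].
  by split => // b _; exact: lex1.
by have [_ h] := cB [set b | exists x, f x = b]; exact: (xgetPex _ h).
Qed.

Lemma Sup_ub (T : Type) (f : T -> B) x : f x <= Sup f.
Proof. by have [ub _] := Sup_supremums f; apply: ub; exists x. Qed.

Lemma Sup_le (T : Type) (f : T -> B) c : (forall x, f x <= c) -> Sup f <= c.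
Proof. by move=> h; have [_] := Sup_supremums f; apply=> _ [x <-]. Qed.

Lemma Inf_lb (T : Type) (f : T -> B) x : Inf f <= f x.
Proof. by have [lb _] := Inf_infimums f; apply: lb; exists x. Qed.

Lemma le_Inf (T : Type) (f : T -> B) c : (forall x, c <= f x) -> c <= Inf f.
Proof. by move=> h; have [_] := Inf_infimums f; apply=> _ [x <-]. Qed.

Lemma le_Sup (T : Type) (f : T -> B) x c : c <= f x -> c <= Sup f.
Proof. by move=> h; apply: le_trans (Sup_ub f x). Qed.

(** Meeting with [c] has the right adjoint [imp c], so it preserves arbitrary suprema. *)
Lemma meet_Sup_le (T : Type) (f : T -> B) c b :
  (forall x, c `&` f x <= b) -> c `&` Sup f <= b.
Proof.
by move=> h; rewrite meetC -le_imp; apply: Sup_le => x; rewrite le_imp meetC.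
Qed.

(** Existential elimination: a witness [x] is fixed at the price of shrinking [c] to its meet with
    [f x]. *)
Lemma Sup_elim (T : Type) (f : T -> B) c b :
  c <= Sup f -> (forall x, c `&` f x <= b) -> c <= b.
Proof. by move=> cf /meet_Sup_le; apply: le_trans; rewrite lexI lexx. Qed.

(** * Equality, membership and mixtures of names *)

Local Notation name := (name B).
Implicit Types x y z : name.

Lemma eqB_sym x y : eqB x y = eqB y x.
Proof.
elim: x y => J f IH a [K g b] /=; rewrite meetC.
congr (_ `&` _); congr Inf; apply/funext => k; congr imp; congr Sup;
  by apply/funext => j; rewrite IH.
Qed.

(** Here and below, [c <= v] reads as [c] forcing the statement of value [v], so that proofs follow
    those for sets. *)
Lemma le_eqB c x y :
  (forall j : nindex x, c `&` val_at j <= memB (elt j) y) ->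
  (forall k : nindex y, c `&` val_at k <= memB (elt k) x) ->
  c <= eqB x y.
Proof.
case: x => J f a; case: y => K g b /= hx hy.
rewrite lexI; apply/andP; split; apply: le_Inf => i; rewrite le_imp; first exact: hx.
apply: (Sup_elim (hy i)) => j /=; apply: (@le_Sup _ _ j).
by apply: leIxr; rewrite eqB_sym.
Qed.

Lemma eqB_elt c x y (j : nindex x) :
  c <= eqB x y -> c <= val_at j -> c <= memB (elt j) y.
Proof.
case: x j => J f a j; case: y => K g b /=; rewrite lexI => /andP[h _].
by apply: imp_elim; apply: le_trans h (Inf_lb _ j).
Qed.

Lemma eqB_refl x : eqB x x = \top.
Proof.
elim: x => J f IH a; apply/eqP; rewrite -le1x.
by apply: le_eqB => j; rewrite meet1x; apply: (@le_Sup _ _ j); rewrite /= IH meetx1.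
Qed.

Lemma eqB_trans c y x z : c <= eqB x y -> c <= eqB y z -> c <= eqB x z.
Proof.
(* [c] is generalized because it shrinks whenever an element is matched with another. *)
elim: x c y z => J f IH a c y z cxy cyz.
apply: le_eqB => [j|l].
- have := @eqB_elt (c `&` a j) (Name f a) y j (leIxl _ cxy) (leIr _ _).
  move/Sup_elim; apply => k; set e := _ `&` _.
  have ec : e <= c by rewrite /e -!meetA leIl.
  have ek : e <= val_at k by rewrite /e; apply: leIxr; rewrite leIl.
  have ej : e <= eqB (f j) (elt k) by rewrite /e; apply: leIxr; rewrite leIr.
  apply: (Sup_elim (eqB_elt (le_trans ec cyz) ek)) => l.
  apply: (@le_Sup _ _ l); rewrite lexI; apply/andP; split.
    by apply: leIxr; rewrite leIl.
  apply: IH (leIxl _ ej) _; by apply: leIxr; rewrite leIr.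
- have czy : c `&` val_at l <= eqB z y by rewrite [leRHS]eqB_sym; exact: leIxl.
  apply: (Sup_elim (eqB_elt czy (leIr _ _))) => k; set e := _ `&` _.
  have ec : e <= c by rewrite /e -!meetA leIl.
  have ek : e <= val_at k by rewrite /e; apply: leIxr; rewrite leIl.
  have el : e <= eqB (elt l) (elt k) by rewrite /e; apply: leIxr; rewrite leIr.
  have eyx : e <= eqB y (Name f a) by rewrite [leRHS]eqB_sym; exact: le_trans cxy.
  apply: (Sup_elim (eqB_elt eyx ek)) => j.
  apply: (@le_Sup _ _ j); rewrite lexI; apply/andP; split.
    by apply: leIxr; rewrite leIl.
  (* The induction hypothesis needs an element of [x] on the left, so the equalities are
     reversed. *)
  rewrite [leRHS]eqB_sym; apply: (@IH j _ (elt k)).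
    by rewrite [leRHS]eqB_sym; apply: leIxr; rewrite leIr.
  by rewrite [leRHS]eqB_sym; exact: leIxl.
Qed.

Lemma memB_eql c x y z : c <= eqB x y -> c <= memB x z -> c <= memB y z.
Proof.
move=> cxy /Sup_elim; apply => k /=; apply: (@le_Sup _ _ k); rewrite lexI.
apply/andP; split; first by apply: leIxr; rewrite leIl.
apply: (@eqB_trans _ x); first by rewrite [leRHS]eqB_sym; exact: leIxl.
by apply: leIxr; rewrite leIr.
Qed.

Lemma le_memB_elt c x y (k : nindex y) :
  c <= val_at k -> c <= eqB x (elt k) -> c <= memB x y.
Proof. by move=> h1 h2; apply: (@le_Sup _ _ k); rewrite lexI h1. Qed.

Lemma name_upair_congr c x y x' y' :
  c <= eqB x x' -> c <= eqB y y' -> c <= eqB (name_upair x y) (name_upair x' y').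
Proof.
move=> hx hy; apply: le_eqB => -[]; rewrite /= meetx1.
- exact: (@le_memB_elt c _ (name_upair x' y') true (lex1 _)).
- exact: (@le_memB_elt c _ (name_upair x' y') false (lex1 _)).
- apply: (@le_memB_elt c _ (name_upair x y) true (lex1 _)).
  by rewrite [leRHS]eqB_sym.
- apply: (@le_memB_elt c _ (name_upair x y) false (lex1 _)).
  by rewrite [leRHS]eqB_sym.
Qed.

Lemma name_tuple_congr c n (xs ys : 'I_n -> name) :
  (forall i, c <= eqB (xs i) (ys i)) ->
  c <= eqB (name_tuple xs) (name_tuple ys).
Proof.
move=> h; rewrite /name_tuple; elim: (enum 'I_n) => [|i s IH].
  by rewrite eqB_refl lex1.
(* Two layers: a Kuratowski pair is an unordered pair of unordered pairs. *)
by apply: name_upair_congr; apply: name_upair_congr.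
Qed.

(** When the weights are pairwise disjoint, only elements coming from [t i] keep a nonzero value
    below [w i]. *)
Definition mix (I : Type) (w : I -> B) (t : I -> name) : name :=
  Name (fun p : {i : I & nindex (t i)} => elt (projT2 p))
       (fun p => w (projT1 p) `&` val_at (projT2 p)).

Lemma mix_eqB (I : Type) (w : I -> B) (t : I -> name) :
  (forall i j, i <> j -> w i `&` w j = \bot) ->
  forall i, w i <= eqB (mix w t) (t i).
Proof.
move=> disj i; apply: le_eqB => [[j k]|k] /=.
  have [ij|/disj ij] := pselect (i = j); last by rewrite meetA ij meet0x le0x.
  subst j; apply: (@le_memB_elt _ _ (t i) k); last by rewrite eqB_refl lex1.
  by apply: leIxr; rewrite leIr.
apply: (@le_memB_elt _ _ (mix w t) (existT _ i k)) => //=.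
by rewrite eqB_refl lex1.
Qed.

End CompleteBooleanAlgebra.

Arguments complete_lattice {d} B.

Lemma ro_complete (X : topologicalType) : complete_lattice (RO X).
Proof.
by move=> A; split; eexists; [exact: ro_supremums|exact: ro_infimums].
Qed.

(** * The model [A_S]: Boolean axioms and mixing *)

Section GenericStructure.
Local Open Scope order_scope.
Variables (R : Type) (ar : R -> nat) (D C kappa : Type).
Variables (code : R + (D + C) -> vset) (S : set (set (fml ar (D + C) kappa))).
Local Notation B := (RO (cond S)).
Local Notation cB := (@ro_complete (cond S)).
Local Notation dom := (ndom (A_Gdot code S)).

Lemma memB_class_name c : memB (class_name code S c) dom = \top.
Proof.
have h : \top <= eqB (class_name code S c) (class_name code S c).
  by rewrite (eqB_refl cB).
by apply/eqP; rewrite -le1x; exact: (@le_memB_elt _ _ cB _ _ dom c (lexx _) h).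
Qed.

Variables (mu : Type) (mu_large : large_enough code S mu).
Variable icst : D + C -> A_S_dom code S mu.
Local Notation M := (A_S icst).

(* Mixing x with a class name on the complement of [x in A_G] gives a name
   that is forced to be in A_G. *)
Lemma A_S_dom_extension (x : name B) : inhabited (D + C) ->
  exists y : A_S_dom code S mu, memB x dom <= eqB x (sval y).
Proof.
move=> [c0]; pose b := memB x dom.
pose w (i : bool) := if i then b else ~` b.
pose t (i : bool) := if i then x else class_name code S c0.
have disj i j : i <> j -> w i `&` w j = \bot.
  by case: i j => -[] // _; rewrite /w ?meetxC // meetC meetxC.
have mixE := mix_eqB cB t disj.
have mem_mix : memB (mix w t) dom = \top.
  (* On [b] the mixture equals [x], which is in [dom] there; on the complement it equals a class
     name, which is always in [dom]. *)
  apply/eqP; rewrite -le1x -(joinxC b) leUx; apply/andP; split.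
    by apply: (memB_eql cB (x := x)) => //; rewrite [leRHS]eqB_sym; exact: (mixE true).
  apply: (memB_eql cB (x := class_name code S c0)).
    by rewrite [leRHS]eqB_sym; exact: (mixE false).
  by rewrite memB_class_name lex1.
(* The mixture need not lie in H_mu, so it is traded for an equal name that does. *)
have [y Hy mix_y] := names_in_Hmu mu_large mem_mix.
have mem_y : memB y dom = \top.
  by apply/eqP; rewrite -le1x; apply: (memB_eql cB (x := mix w t));
    rewrite ?mix_y ?mem_mix.
exists (exist _ y (conj Hy mem_y)) => /=.
apply: (eqB_trans cB (y := mix w t)); last by rewrite mix_y lex1.
by rewrite [leRHS]eqB_sym; exact: (mixE true).
Qed.

Lemma A_S_bmodel : inhabited (D + C) -> is_bmodel M.
Proof.
move=> [c0]; split.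
- exact: (inhabits (icst c0)).
- by move=> x; exact: (eqB_refl cB).
- by move=> x y; exact: eqB_sym.
- by move=> x y z; apply: (eqB_trans cB (y := sval y)); rewrite ?leIl ?leIr.
(* A relation is membership of the tuple name in a fixed name, so congruence is that of [memB]. *)
- move=> r xs ys /=; apply: (memB_eql cB); last exact: leIr.
  by apply: (name_tuple_congr cB) => i; apply: leIxl; exact: meets_inf.
Qed.

Lemma A_S_mixing : inhabited (D + C) -> mixing M.
Proof.
move=> ne A anti t.
have disj (a a' : A) : a <> a' -> val a `&` val a' = \bot.
  by move=> aa'; apply: anti; [exact: set_valP|exact: set_valP|move=> /val_inj].
have mixE := mix_eqB cB (fun a => sval (t a)) disj.
(* Off the supremum of [A] the mixture need not be in the structure; the extension repairs this
   without changing it below any [a]. *)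
have [y hy] := A_S_dom_extension (mix val (fun a => sval (t a))) ne.
exists y => a /=.
apply: (eqB_trans cB); last exact: mixE.
rewrite [leRHS]eqB_sym; apply: le_trans hy.
apply: (memB_eql cB (x := sval (t a))); first by rewrite [leRHS]eqB_sym; exact: mixE.
by have [_ ->] := svalP (t a); exact: lex1.
Qed.

(** * Comparison of truth values in [A_S] and in the named structure *)

Hypothesis icst_name : forall c, eqB (sval (icst c)) (class_name code S c) = \top.
Hypothesis ne : inhabited (D + C).

Lemma term_eqB (b : B) (e : nat -> bdom M) (e' : nat -> name B) t :
  (forall n, tfv t n -> b <= eqB (sval (e n)) (e' n)) ->
  b <= eqB (sval (btval e t)) (ntval (A_Gdot code S) e' t).
Proof. by case: t => [n|c] /= h; [exact: h|rewrite icst_name lex1]. Qed.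

(** [F] stands for the free variables of the matrix, so the first hypothesis is what the quantified
    formula supplies. *)
Lemma update_eqB (b : B) (e : nat -> bdom M) (e' : nat -> name B) vs
    (xs : 'I_(size vs) -> bdom M) (ys : 'I_(size vs) -> name B) (F : set nat) :
  (forall n, (F `\` [set` vs])%classic n -> b <= eqB (sval (e n)) (e' n)) ->
  (forall i, b <= eqB (sval (xs i)) (ys i)) ->
  forall n, F n -> b <= eqB (sval (update e xs n)) (update e' ys n).
Proof.
move=> he hxs n Fn; rewrite /update; case: insubP => [i _ _|]; first exact: hxs.
by rewrite index_mem => /negP nvs; exact: he.
Qed.

(** Coordinates are replaced separately, since each is in the domain with at least the value of the
    whole tuple. *)
Lemma A_S_tuple_extension n (ys : 'I_n -> name B) :
  exists xs : 'I_n -> bdom M,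
    forall i, memB_tuple (A_Gdot code S) ys <= eqB (sval (xs i)) (ys i).
Proof.
have [xs hxs] := choice (fun i => A_S_dom_extension (ys i) ne).
exists xs => i; rewrite [leRHS]eqB_sym; apply: le_trans (hxs i); exact: meets_inf.
Qed.

Lemma memB_tuple_A_S n (xs : 'I_n -> bdom M) :
  memB_tuple (A_Gdot code S) (fun i => sval (xs i)) = \top.
Proof. by apply: big1 => i _; have [] := svalP (xs i). Qed.

(* Relativizing to b, the value where the two assignments agree, is what makes
   the induction go through the quantifiers. *)
Lemma bval_sat (phi : fml ar (D + C) kappa) (b : B)
    (e : nat -> bdom M) (e' : nat -> name B) :
  (forall n, fv phi n -> b <= eqB (sval (e n)) (e' n)) ->
  b `&` bval phi e <= sat (A_Gdot code S) phi e' /\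
  b `&` sat (A_Gdot code S) phi e' <= bval phi e.
Proof.
elim: phi b e e' => [t u|r ts|phi IH|J F IH|J F IH|vs phi IH|vs phi IH] b e e' /= h.
- have ht := term_eqB (fun n tn => h n (or_introl tn)).
  have hu := term_eqB (fun n un => h n (or_intror un)).
  split.
    apply: (eqB_trans cB); last exact: leIxl hu.
    apply: (eqB_trans cB); last exact: leIr.
    by rewrite [leRHS]eqB_sym; exact: leIxl.
  apply: (eqB_trans cB); last by rewrite [leRHS]eqB_sym; exact: leIxl hu.
  apply: (eqB_trans cB); last exact: leIr.
  exact: leIxl.
- have ht i : b <= eqB (sval (btval e (tnth ts i)))
      (ntval (A_Gdot code S) e' (tnth ts i)).
    by apply: term_eqB => n tn; apply: h; exists i.
  split; apply: (memB_eql cB); [|exact: leIr| |exact: leIr];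
    apply: (name_tuple_congr cB) => i; apply: leIxl => //.
  by rewrite [leRHS]eqB_sym.
- by have [h1 h2] := IH _ _ _ h; split; exact: meet_compl_le.
- have {}IH i : _ /\ _ := IH i b e e' (fun n Fn => h n (ex_intro2 _ _ i I Fn)).
  by split; apply: (le_Inf cB) => i; have [h1 h2] := IH i;
    [apply: le_trans h1|apply: le_trans h2]; rewrite leI2 //;
    exact: (Inf_lb cB _ i).
- have {}IH i : _ /\ _ := IH i b e e' (fun n Fn => h n (ex_intro2 _ _ i I Fn)).
  by split; apply: (meet_Sup_le cB) => i; have [h1 h2] := IH i;
    exact: (le_Sup cB (x := i)).
- split; apply: (le_Inf cB).
    (* Below [m], an arbitrary tuple of names agrees with a tuple from [A_S], to which the infimum
       applies. *)
    move=> ys; rewrite le_imp meetAC; set m := memB_tuple _ _.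
    have [xs hxs] := A_S_tuple_extension ys.
    have [|h1 _] := IH (b `&` m) (update e xs) (update e' ys).
      by apply: update_eqB => [n Fn|i]; [exact/leIxl/h|exact/leIxr/hxs].
    by apply: le_trans h1; rewrite leI2 // (Inf_lb cB).
  (* A tuple from [A_S] is itself a tuple of names, and its guard has value [\top]. *)
  move=> xs; have [|_ h2] := IH b (update e xs) (update e' (fun i => sval (xs i))).
    by apply: update_eqB => // i; rewrite (eqB_refl cB) lex1.
  apply: le_trans h2; rewrite leI2 //.
  apply: le_trans (Inf_lb cB _ (fun i => sval (xs i))) _.
  by rewrite memB_tuple_A_S imp1x.
- split; apply: (meet_Sup_le cB).
    move=> xs; apply: (le_Sup cB (x := fun i => sval (xs i))).
    rewrite memB_tuple_A_S meet1x.
    have [|h1 _] := IH b (update e xs) (update e' (fun i => sval (xs i))) => //.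
    by apply: update_eqB => // i; rewrite (eqB_refl cB) lex1.
  move=> ys; rewrite meetA; set m := memB_tuple _ _.
  (* The guard [m] of the witness [ys] provides a witness in [A_S] that equals it below [m]. *)
  have [xs hxs] := A_S_tuple_extension ys.
  apply: (le_Sup cB (x := xs)).
  have [|_ h2] := IH (b `&` m) (update e xs) (update e' ys) => //.
  by apply: update_eqB => [n Fn|i]; [exact/leIxl/h|exact/leIxr/hxs].
Qed.

Lemma bval_sat_sentence (phi : fml ar (D + C) kappa)
    (e : nat -> bdom M) (e' : nat -> name B) :
  sentence phi -> bval phi e = sat (A_Gdot code S) phi e'.
Proof.
move=> [_ fv0]; have [|h1 h2] := @bval_sat phi \top e e'.
  (* Without free variables any two assignments agree with value [\top]. *)
  by rewrite fv0.
by apply/le_anti; rewrite !meet1x in h1 h2; rewrite h1 h2.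
Qed.

End GenericStructure.

Theorem theorem5p15 (R : Type) (ar : R -> nat) (D C kappa : Type)
    (code : R + (D + C) -> vset)
    (code_inj : forall x y, veq (code x) (code y) -> x = y)
    (CD_nonempty : inhabited (D + C))
    (C_kappa : [set: C] #<= [set: kappa])
    (S : set (set (fml ar (D + C) kappa)))
    (S_fin : forall s, S s -> finite_set s /\ (forall phi, s phi -> sentence phi))
    (S_cons : consistency_property S)
    (mu : Type) (mu_large : large_enough code S mu)
    (icst : D + C -> A_S_dom code S mu)
    (icst_name : forall c, eqB (sval (icst c)) (class_name code S c) = \top) :
  [/\ is_bmodel (A_S icst),
      mixing (A_S icst)
    & forall s, S s ->
      forall (e : nat -> bdom (A_S icst)) (e' : nat -> name (RO (cond S))),
      bval_conj s e = sat_conj (A_Gdot code S) s e'].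
Proof.
split; [exact: A_S_bmodel|exact: A_S_mixing|move=> s Ss e e'].
(* Both conjunctions are infima over the same set [s], so they are compared termwise. *)
congr Inf; apply/funext => phi; apply: bval_sat_sentence => //.
by have [_] := S_fin _ Ss; apply; exact: set_valP.
Qed.
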